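(* Suppose that $$H(\theta) \ge \theta h_m+\left(p' \int_{0}^1 D^{p'-1}(u)\, g(u) \,\mathrm{d} u\right)^{\frac{1}{p'}}.$$ Then the boundary value problem $$\begin{cases}\left(D(u)|u'|^{p-2}u'\right)' +\left(c+h(u)\right)u' +g(u)=0 \quad \text{on } \mathbb{R},\\ u(-\infty)=1,\quad u(+\infty)=0\end{cases}$$ has no solution (in the sense defined in the context) for any $c>-h_m$. If moreover the strict inequality $$H(\theta) > \theta h_m+\left(p' \int_{0}^1 D^{p'-1}(u)\, g(u) \,\mathrm{d} u\right)^{\frac{1}{p'}}$$ holds, then there is no solution for any $c\ge -h_m$.
   Context: Standing assumptions and notation. $p>1$ is real and $p'=\frac{p}{p-1}$. $D\in C^1(0,1)$ with $D>0$ in $(0,1)$ ($D$ may degenerate or be singular at $0$ and/or $1$). $h\in C[0,1]$, $H(u)=\int_0^u h(s)\,\mathrm{d}s$ (so $H\in C^1[0,1]$, $H(0)=0$), and $h_m=\min_{u\in[0,1]}h(u)$. $\theta\in(0,1)$, and $g\in C[0,1]$ satisfies $g=0$ in $[0,\theta]$, $g>0$ in $(\theta,1)$, $g(1)=0$. It is assumed that $\int_0^1 D^{p'-1}(u)g(u)\,\mathrm{d}u<+\infty$. The constant $c$ is real. Definition of solution. For given $c\in\mathbb{R}$, a continuous function $u:\mathbb{R}\to[0,1]$ is a solution of the boundary value problem if: (a) $u\in C^1(I_u)$, where $I_u=\{\xi\in\mathbb{R}: 0<u(\xi)<1\}$, and the equation holds at every point of $I_u$ (in particular $\xi\mapsto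 D(u(\xi))|u'(\xi)|^{p-2}u'(\xi)$ belongs to $C^1(I_u)$); (b) the function $\xi\mapsto D(u(\xi))|u'(\xi)|^{p-2}u'(\xi)$ (understood as $0$ at points where $u\in\{0,1\}$) is continuous on $\mathbb{R}$, and $D(u(\xi))|u'(\xi)|^{p-2}u'(\xi)\to 0$ as $u(\xi)\to 0$ and as $u(\xi)\to 1$; (c) $u(\xi)\to 1$ as $\xi\to-\infty$ and $u(\xi)\to 0$ as $\xi\to+\infty$. *)

(* Defs.v *)
From HB Require Import structures.
From mathcomp Require Import all_boot all_order all_algebra.
From mathcomp Require Import all_classical all_reals all_analysis.

Set Implicit Arguments.
Unset Strict Implicit.
Unset Printing Implicit Defensive.

Import Order.TTheory GRing.Theory Num.Theory.
Import numFieldNormedType.Exports.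

Local Open Scope ring_scope.
Local Open Scope classical_set_scope.

Definition conj_exp (R : realType) (p : R) : R := p / (p - 1).

(* Only used for open sets [A], where (two-sided) differentiability and
   continuity of the derivative at each point of [A] depend on [f] only
   through its restriction to [A]. *)
Definition C1_on (R : realType) (A : set R) (f : R -> R) : Prop :=
  forall x, A x -> derivable f x 1 /\ {for x, continuous (derive1 f)}.

Definition is_min_on (R : realType) (A : set R) (f : R -> R) (m : R) : Prop :=
  (exists2 x, A x & f x = m) /\ (forall x, A x -> m <= f x).

(* Meant for [0 <= u]. *)
Definition primitive0 (R : realType) (h : R -> R) (u : R) : R :=
  \int[lebesgue_measure]_(s in `[0, u]) h s.

Definition inner_set (R : realType) (u : R -> R) : set R :=
  [set x | 0 < u x < 1].

(* Where [u' = 0] the value is [0] also for [p < 2], since [powR] is total. *)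
Definition flux (R : realType) (p : R) (D u : R -> R) (x : R) : R :=
  if 0 < u x < 1 then D (u x) * `|derive1 u x| `^ (p - 2) * derive1 u x else 0.

(* [sol_flux_at0] and [sol_flux_at1] are the limits of the flux at [x] as
   [u x] tends to [0] and to [1], uniformly in the position of [x]. *)
Record is_solution (R : realType) (p : R) (D h g : R -> R) (c : R)
    (u : R -> R) : Prop := IsSolution {
  sol_continuous : continuous u ;
  sol_range : forall x, 0 <= u x <= 1 ;
  sol_C1 : C1_on (inner_set u) u ;
  sol_flux_C1 : C1_on (inner_set u) (flux p D u) ;
  sol_eq : forall x, inner_set u x ->
    derive1 (flux p D u) x + (c + h (u x)) * derive1 u x + g (u x) = 0 ;
  sol_flux_continuous : continuous (flux p D u) ;
  sol_flux_at0 : forall e : R, 0 < e -> exists2 d : R, 0 < d &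
    forall x, `|u x| < d -> `|flux p D u x| < e ;
  sol_flux_at1 : forall e : R, 0 < e -> exists2 d : R, 0 < d &
    forall x, `|u x - 1| < d -> `|flux p D u x| < e ;
  sol_lim_ninfty : u x @[x --> -oo] --> (1 : R) ;
  sol_lim_pinfty : u x @[x --> +oo] --> (0 : R)
}.

(* Main.v *)
Require Import Defs.
From HB Require Import structures.
From mathcomp Require Import all_boot all_order all_algebra.
From mathcomp Require Import all_classical all_reals all_analysis.
From mathcomp Require Import ring lra.

Set Implicit Arguments.
Unset Strict Implicit.
Unset Printing Implicit Defensive.

Import Order.TTheory GRing.Theory Num.Theory.
Import numFieldNormedType.Exports.

Local Open Scope ring_scope.
Local Open Scope classical_set_scope.

(* Let phi be the flux and q the conjugate exponent of p. Since
   |phi|^(q-2) phi = D(u)^(q-1) u', multiplying the equation by this quantity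
   shows that, where 0 < u < 1, the derivative of
     G(u) + |phi|^q / q,   with G' = D^(q-1) g,
   is -(c + h(u)) D(u)^(q-1) u'^2 <= 0. Let x1 be the last point with
   u(x1) = theta. Going left from x1 until u is close to 0 or 1, where phi is
   small, gives |phi(x1)|^q <= q int_0^1 D^(q-1) g. Going right from x1,
   phi + c u + H(u) is constant because g(u) = 0, and it is small when u is
   close to 0; hence c theta + H(theta) = - phi(x1). *)

(** * Conjugate exponents and powers of absolute values *)

Lemma conj_exp_gt1 (R : realType) (p : R) : 1 < p -> 1 < conj_exp p.
Proof.
by move=> p1; rewrite /conj_exp ltr_pdivlMr ?mul1r ?gtrBl// subr_gt0.
Qed.

(** For [v] nonzero the powers of [|v|] have total exponent (p - 2)(q - 2) + (q - 2) + (p - 2) = (p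
    - 1)(q - 1) - 1 = 0 by conjugacy, so only a power of [d] and the last factor [v] remain. *)
Lemma conj_exp_powR_flux (R : realType) (p d v : R) : 1 < p -> 0 < d ->
  `|d * `|v| `^ (p - 2) * v| `^ (conj_exp p - 2) * (d * `|v| `^ (p - 2) * v) =
  d `^ (conj_exp p - 1) * v.
Proof.
move=> p1 d0; set q := conj_exp p.
have [->|v0] := eqVneq v 0; first by rewrite !mulr0.
have nv0 : `|v| != 0 by rewrite normr_eq0.
have Epq : (p - 2) * (q - 2) + (q - 2) + (p - 2) = 0.
  by rewrite /q /conj_exp; field; rewrite subr_eq0 gt_eqF.
have Ev : (`|v| `^ (p - 2)) `^ (q - 2) * `|v| `^ (q - 2) * `|v| `^ (p - 2) = 1.
  by rewrite -powRrM -!powRD ?nv0 ?implybT// Epq powRr0.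
have -> : d `^ (q - 1) = d `^ (q - 2) * d.
  rewrite -[X in _ * X](powRr1 (ltW d0)) -powRD ?(gt_eqF d0) ?implybT//.
  by congr (_ `^ _); ring.
rewrite !normrM (gtr0_norm d0) (ger0_norm (powR_ge0 _ _)).
rewrite !powRM ?mulr_ge0 ?powR_ge0 ?normr_ge0 ?(ltW d0)//.
rewrite -[RHS]mulr1 -[X in _ = _ * X]Ev; ring.
Qed.

(** Away from 0 this is the chain rule for the power of [y] or of [- y]. At 0 the difference
    quotient has absolute value |h|^(q - 1), which tends to 0 because q > 1. *)
Lemma is_derive_norm_powR (R : realType) (q x : R) : 1 < q ->
  is_derive x 1 (fun y => `|y| `^ q) (q * `|x| `^ (q - 2) * x).
Proof.
move=> q1.
have powRB2 (y : R) : 0 < y -> y `^ (q - 2) * y = y `^ (q - 1).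
  move=> y0; rewrite -[X in _ * X](powRr1 (ltW y0)).
  rewrite -powRD ?(gt_eqF y0) ?implybT//.
  by congr (_ `^ _); ring.
have [x0|x0|->] := ltgtP x 0.
- have -> : q * `|x| `^ (q - 2) * x = (q * (- x) `^ (q - 1)) * (- 1).
    by rewrite ltr0_norm// -powRB2 ?oppr_gt0//; ring.
  apply: (@near_eq_is_derive _ _ _ ((fun y => y `^ q) \o -%R)).
    near=> y; rewrite /= ltr0_norm//.
    by near: y; exact: lt_nbhsl.
  apply: is_derive1_comp.
  by apply: is_derive1_powR; rewrite oppr_gt0.
- rewrite gtr0_norm// -mulrA powRB2//.
  apply: (@near_eq_is_derive _ _ _ (fun y => y `^ q)).
    near=> y; rewrite /= gtr0_norm//.
    by near: y; exact: lt_nbhsr.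
  exact: is_derive1_powR.
- rewrite mulr0.
  have q0 : 0 < q - 1 by rewrite subr_gt0.
  have cv : (fun h : R => h^-1 *:
      (`|h *: (1 : R) + 0 : R| `^ q - `|0 : R| `^ q)) @ 0^' --> (0 : R).
    apply/cvgrPdist_lt => e e0; near=> h.
    have h0 : 0 < `|h| by rewrite normr_gt0; near: h; exact: nbhs_dnbhs_neq.
    rewrite sub0r normrN normr0 powR0 ?gt_eqF ?(lt_trans _ q1)// subr0 addr0.
    rewrite [h *: 1]mulr1 normrZ normfV (ger0_norm (powR_ge0 _ _)).
    rewrite -(mulr_powRB1 (ltW h0)) ?(lt_trans _ q1)// mulKf ?gt_eqF//.
    (* With [e] written as a (q - 1)-th power, monotonicity reduces the bound to |h| < e^(1/(q -
       1)). *)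
    have -> : e = (e `^ (q - 1)^-1) `^ (q - 1).
      by rewrite -powRrM mulVf ?gt_eqF// powRr1// ltW.
    rewrite gt0_ltr_powR// ?nnegrE ?powR_ge0//.
    by near: h; apply: dnbhs0_lt; rewrite powR_gt0.
  apply: DeriveDef; first by apply/cvg_ex; exists 0.
  exact/cvg_lim.
Unshelve. all: by end_near. Qed.

(** * Level crossings of continuous functions *)

Lemma first_exit (R : realType) (f : R -> R) (a b : R) :
  continuous f -> a <= b -> 0 <= f a -> f b <= 0 ->
  exists x, [/\ a <= x <= b, f x = 0 & forall y, a <= y <= x -> 0 <= f y].
Proof.
move=> fC ab fa fb.
(* [x] will be the least element of this compact set. Before it [f] is positive, and the
   intermediate value theorem then forces [f x = 0]. *)
pose S := `[a, b] `&` [set x | f x <= 0].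
have Sb : S b by split; rewrite //= in_itv/= ab lexx.
have cS : compact S.
  apply: compact_closedI; first exact: segment_compact.
  by apply: (@preimage_closed _ _ f [set x | x <= 0]) => //; exact: closed_le.
have [x /set_mem[/= + fx0] minx] := @compact_EVT_min _ _ id S
  (ex_intro _ b Sb) cS (continuous_subspaceT (fun=> @cvg_id _ _)).
rewrite in_itv/= => /andP[ax xb].
have lt_gt0 y : a <= y < x -> 0 < f y.
  move=> /andP[ay yx]; rewrite ltNge; apply/negP => fy.
  have /minx : y \in S.
    by rewrite inE; split; rewrite //= in_itv/= ay ltW// (lt_le_trans yx).
  by rewrite leNgt yx.
have fx : f x = 0.
  have [z] := @IVT _ f a x 0 ax (continuous_subspaceT fC)
    ltac:(by rewrite ge_min le_max fx0 fa orbT).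
  rewrite in_itv/= => /andP[az]; rewrite le_eqVlt => /predU1P[<-//|zx] fz.
  by have := lt_gt0 z; rewrite az zx fz ltxx => /(_ isT).
exists x; split => //; first by rewrite ax xb.
move=> y /andP[ay]; rewrite le_eqVlt => /predU1P[->|yx]; first by rewrite fx.
by rewrite ltW// lt_gt0// ay.
Qed.

(** The mirror image of [first_exit] under x -> - x. *)
Lemma last_entry (R : realType) (f : R -> R) (a b : R) :
  continuous f -> a <= b -> f a <= 0 -> 0 <= f b ->
  exists x, [/\ a <= x <= b, f x = 0 & forall y, x <= y <= b -> 0 <= f y].
Proof.
move=> fC ab fa fb.
have [||||x [xab fx xP]] := @first_exit _ (f \o -%R) (- b) (- a).
- by move=> x; apply: continuous_comp; [exact: opp_continuous|exact: fC].
- by rewrite lerN2.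
- by rewrite /= opprK.
- by rewrite /= opprK.
exists (- x); split => //; first by rewrite lerNr lerNl andbC.
move=> y /andP[xy yb]; have := xP (- y).
by rewrite /= opprK lerN2 yb lerNl xy => /(_ isT).
Qed.

Lemma C1_on_is_derive (R : realType) (A : set R) (f : R -> R) (x : R) :
  C1_on A f -> A x -> is_derive x 1 f (derive1 f x).
Proof.
by move=> fC1 /fC1[df _]; rewrite derive1E; exact/derivableP.
Qed.

(** * Energy decay and a first integral along a solution *)

Section solution.
Variables (R : realType) (p c theta : R) (D h g u : R -> R).
Hypothesis p1 : 1 < p.
Hypothesis usol : is_solution p D h g c u.
Let q := conj_exp p.
Let phi := flux p D u.

Let q1 : 1 < q. Proof. exact: conj_exp_gt1. Qed.
Let q0 : 0 < q. Proof. exact: lt_trans q1. Qed.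

Lemma energy_nincr (G : R -> R) (a b : R) :
  (forall s, 0 < s < 1 -> 0 < D s) -> (forall s, 0 <= s <= 1 -> 0 <= c + h s) ->
  (forall s : R, 0 < s < 1 -> is_derive s 1 G (D s `^ (q - 1) * g s)) ->
  a <= b -> (forall x, a <= x <= b -> 0 < u x < 1) ->
  G (u b) + `|phi b| `^ q / q <= G (u a) + `|phi a| `^ q / q.
Proof.
move=> D_gt0 ch_ge0 dG ab ab01.
pose E' x := D (u x) `^ (q - 1) * g (u x) * derive1 u x
  + q * `|phi x| `^ (q - 2) * phi x * derive1 phi x * q^-1.
have dE x : a <= x <= b ->
    is_derive x 1 (fun x => G (u x) + `|phi x| `^ q / q) (E' x).
  move=> /ab01 ux.
  have du := C1_on_is_derive (sol_C1 usol) ux.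
  have dphi := C1_on_is_derive (sol_flux_C1 usol) ux.
  apply: is_deriveD; first exact: is_derive1_comp (dG _ ux) du.
  have dn := is_derive1_comp (is_derive_norm_powR (phi x) q1) dphi.
  have := is_deriveM dn (is_derive_cst q^-1 x 1).
  by rewrite scaler0 add0r [_ *: _]mulrC.
have E'_le0 x : a <= x <= b -> E' x <= 0.
  move=> /ab01 ux.
  have D0 := D_gt0 _ ux.
  have Ephi : `|phi x| `^ (q - 2) * phi x = D (u x) `^ (q - 1) * derive1 u x.
    by rewrite /phi /flux ux conj_exp_powR_flux.
  (* Substituting the equation for [derive1 phi x] cancels the term with [g]; only the dissipation
     remains. *)
  have -> : E' x = - ((c + h (u x)) * D (u x) `^ (q - 1) * derive1 u x ^+ 2).
    have -> : E' x = D (u x) `^ (q - 1) * g (u x) * derive1 u x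
        + (`|phi x| `^ (q - 2) * phi x) * derive1 phi x.
      by rewrite /E'; field; rewrite gt_eqF.
    have := sol_eq usol ux; rewrite -/phi Ephi => /eqP.
    rewrite -addrA addr_eq0 => /eqP ->; ring.
  have chu : 0 <= c + h (u x) by apply: ch_ge0; exact: sol_range usol x.
  by rewrite oppr_le0 mulr_ge0 ?sqr_ge0// mulr_ge0// powR_ge0.
have [||z] := @MVT_segment _ (fun x => G (u x) + `|phi x| `^ q / q) E' _ _ ab.
- by move=> x; rewrite in_itv/= => /andP[ax xb]; apply: dE; rewrite !ltW.
- apply: derivable_within_continuous => x; rewrite in_itv/= => xab.
  by case: (dE x xab).
rewrite in_itv/= => zab Ez; rewrite -subr_le0 Ez.
by rewrite mulr_le0_ge0 ?E'_le0// subr_ge0.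
Qed.

Lemma flux_conserved (H : R -> R) (a b : R) :
  (forall s, 0 <= s <= theta -> g s = 0) -> theta < 1 ->
  (forall s : R, 0 < s < 1 -> is_derive s 1 H (h s)) ->
  a <= b -> (forall x, a <= x <= b -> 0 < u x <= theta) ->
  phi b + (c * u b + H (u b)) = phi a + (c * u a + H (u a)).
Proof.
move=> g_eq0 theta1 dH ab ab_theta.
have dF x : a <= x <= b ->
    is_derive x 1 (fun x => phi x + (c * u x + H (u x))) 0.
  move=> /ab_theta /andP[u0 utheta].
  have ux : 0 < u x < 1 by rewrite u0 (le_lt_trans utheta).
  have du := C1_on_is_derive (sol_C1 usol) ux.
  have dphi := C1_on_is_derive (sol_flux_C1 usol) ux.
  (* The claimed derivative 0 is replaced by the left side of the equation, where [g (u x) = 0], so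
     that the sum and chain rules match it term by term. *)
  have := sol_eq usol ux; rewrite g_eq0 ?utheta ?andbT ?ltW// addr0 => <-.
  rewrite mulrDl; apply: is_deriveD; apply: is_deriveD.
  exact: is_derive1_comp (dH _ ux) du.
have [||z _ /eqP] :=
  @MVT_segment _ (fun x => phi x + (c * u x + H (u x))) (fun=> 0) _ _ ab.
- by move=> x; rewrite in_itv/= => /andP[ax xb]; apply: dF; rewrite !ltW.
- apply: derivable_within_continuous => x; rewrite in_itv/= => xab.
  by case: (dF x xab).
by rewrite mul0r subr_eq0 => /eqP.
Qed.

End solution.

Lemma C1_on_continuous (R : realType) (A : set R) (f : R -> R) (x : R) :
  C1_on A f -> A x -> {for x, continuous f}.
Proof.
move=> fC1 /fC1[df _]; apply: differentiable_continuous.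
exact/derivable1_diffP.
Qed.

(** * Primitives of [h] and of the weighted reaction term *)

Section primitive.
Variables (R : realType) (h : R -> R).
Hypothesis h_cont : {within `[0, 1], continuous h}.

Let h_int : lebesgue_measure.-integrable `[0, 1] (EFin \o h).
Proof.
by apply: continuous_compact_integrable => //; exact: segment_compact.
Qed.

Lemma is_derive_primitive0 (s : R) : 0 < s < 1 ->
  is_derive s 1 (primitive0 h) (h s).
Proof.
move=> /andP[s0 s1].
have [||dH Hs] := continuous_FTC1 s1 h_int.
- by rewrite /= lte_fin.
- by apply: within_continuous_continuous h_cont _ => //; rewrite in_itv/= s0.
by apply: DeriveDef => //; rewrite -derive1E.
Qed.

(** The limit is two-sided: for [s < 0] the interval of integration is empty and the integral is
    0. *)
Lemma primitive0_cvg0 : primitive0 h s @[s --> 0] --> 0.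
Proof. exact: (@parameterized_integral_cvg_left R 0 1 h ltr01 h_int). Qed.

End primitive.

Section weighted.
Variables (R : realType) (r : R) (D g : R -> R).
Let F s := D s `^ r * g s.
Let mu := @lebesgue_measure R.
Hypothesis D_C1 : C1_on `]0, 1[ D.
Hypothesis D_gt0 : forall s : R, 0 < s < 1 -> 0 < D s.
Hypothesis g_cont : {within `[0, 1], continuous g}.
Hypothesis g_ge0 : forall s : R, 0 < s < 1 -> 0 <= g s.
Hypothesis F_int : (\int[mu]_(s in `]0%R, 1%R[) (F s)%:E < +oo)%E.

Let F_ge0 s : 0 < s < 1 -> 0 <= F s.
Proof. by move=> s01; rewrite mulr_ge0 ?powR_ge0 ?g_ge0. Qed.

Let F_cont s : 0 < s < 1 -> {for s, continuous F}.
Proof.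
move=> s01; apply: cvgM.
  apply: (@continuous_comp _ _ _ D (fun y => y `^ r)).
    by apply: C1_on_continuous D_C1 _; rewrite /= in_itv.
  apply: differentiable_continuous; apply/derivable1_diffP.
  by apply: derivable_powR; rewrite in_itv/= D_gt0.
exact: within_continuous_continuous ltr01 g_cont _.
Qed.

Let F_integrable : mu.-integrable `]0, 1[ (EFin \o F).
Proof.
apply/integrableP; split.
  apply/measurable_realfun.measurable_EFinP.
  apply: measurable_realfun.open_continuous_measurable_fun => //.
  by move=> s; rewrite inE/= in_itv/= => /F_cont.
move: F_int; congr (_ < _)%E; apply: eq_integral => s.
by rewrite inE/= in_itv/= => s01; rewrite ger0_norm ?F_ge0.
Qed.

(** [G s] is the integral of [F] over the half-open interval from 0 to [s], which avoids the
    endpoint 0 where [D] may be singular. Both bounds come from [F >= 0]. *)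
Lemma weighted_primitive : exists G : R -> R,
  [/\ forall s : R, 0 < s < 1 -> is_derive s 1 G (F s),
      forall s : R, 0 < s < 1 -> 0 <= G s &
      forall s : R, 0 < s < 1 -> G s <= \int[mu]_(s in `]0, 1[) F s].
Proof.
have sub (s : R) : s < 1 -> `]0, s] `<=` (`]0, 1[ : set R).
  by move=> s1 x; rewrite /= !in_itv/= => /andP[-> /le_lt_trans->].
have Fi (s : R) : s < 1 -> mu.-integrable `]0, s] (EFin \o F).
  by move=> s1; apply: integrableS F_integrable => //; exact: sub.
exists (fun s => \int[mu]_(t in `]0, s]) F t).
split => s /[dup] s01 /andP[s0 s1].
(* The midpoint of [s] and 1 serves as right end for the fundamental theorem: [s] lies strictly
   before it, and [F] is integrable up to it. *)
- have s2 : s < (s + 1) / 2 by lra.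
  have s3 : (s + 1) / 2 < 1 by lra.
  have [||dG Gs] := @continuous_FTC1 _ F (BRight 0) _ _ s2 _ _ (F_cont s01).
  + exact: Fi.
  + by rewrite /= lte_fin.
  by apply: DeriveDef => //; rewrite -derive1E.
- apply: Rintegral_ge0 => x /(sub _ s1); rewrite /= in_itv/=; exact: F_ge0.
- apply: fine_le; first exact: integrable_fin_num (Fi _ s1).
    exact: integrable_fin_num F_integrable.
  apply: ge0_subset_integral => //.
  + by case/integrableP: F_integrable.
  + exact: sub.
Qed.

End weighted.

(** * Behaviour at infinity and the last point at a given level *)

Lemma cvg_pinfty_bound (R : realType) (f : R -> R) (l e : R) :
  f x @[x --> +oo] --> l -> 0 < e ->
  exists M, forall x, M <= x -> `|l - f x| < e.
Proof.
move=> /cvgrPdist_lt/[apply] -[M [_ HM]].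
(* Neighbourhoods of +oo contain open half-lines; the shift by 1 gives a closed one. *)
exists (M + 1) => x Mx; apply: HM; apply: lt_le_trans Mx; rewrite ltrDl//.
Qed.

Lemma cvg_ninfty_bound (R : realType) (f : R -> R) (l e : R) :
  f x @[x --> -oo] --> l -> 0 < e ->
  exists M, forall x, x <= M -> `|l - f x| < e.
Proof.
move=> /cvgrPdist_lt/[apply] -[M [_ HM]].
exists (M - 1) => x Mx; apply: HM; apply: le_lt_trans Mx _; rewrite gtrBl//.
Qed.

(** Far to the left [u > t] and from [b] on [u < t], so the last entry of [t - u] into the
    nonnegative values before [b] is the point sought. *)
Lemma last_at_level (R : realType) (p c t : R) (D h g u : R -> R) :
  is_solution p D h g c u -> 0 < t < 1 ->
  exists x, u x = t /\ forall y, x <= y -> u y <= t.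
Proof.
move=> usol /andP[t0 t1].
have [b ub] := cvg_pinfty_bound (sol_lim_pinfty usol) t0.
have [a ua] : exists a, forall x, x <= a -> `|1 - u x| < 1 - t.
  by apply: cvg_ninfty_bound (sol_lim_ninfty usol) _; rewrite subr_gt0.
have [||||x [/andP[_ xb] /eqP ux xP]] :=
  @last_entry _ (fun x => t - u x) (Num.min a b) b.
- by move=> x; apply: cvgB; [exact: cvg_cst|exact: sol_continuous usol x].
- by rewrite ge_min lexx orbT.
- have /ua : Num.min a b <= a by rewrite ge_min lexx.
  by rewrite ltr_norml => /andP[_ ?]; lra.
- by have := ub b (lexx _); rewrite ltr_norml => /andP[? _]; lra.
exists x; split; first by move: ux; rewrite subr_eq0 => /eqP.
move=> y xy; have [yb|/ltW/ub] := leP y b.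
  by rewrite -subr_ge0; apply: xP; rewrite xy.
by rewrite ltr_norml => /andP[? _]; lra.
Qed.

(** * Two bounds for the flux at a point of height [theta] *)

Section bounds.
Variables (R : realType) (p c theta x1 : R) (D h g u : R -> R).
Hypothesis p1 : 1 < p.
Hypothesis theta01 : 0 < theta < 1.
Hypothesis D_gt0 : forall s : R, 0 < s < 1 -> 0 < D s.
Hypothesis usol : is_solution p D h g c u.
Hypothesis ux1 : u x1 = theta.
Let q := conj_exp p.
Let phi := flux p D u.

Let q1 : 1 < q. Proof. exact: conj_exp_gt1. Qed.
Let q0 : 0 < q. Proof. exact: lt_trans q1. Qed.

(** As [u] need not be monotone, going left from [x1] it may approach either 0 or 1. The energy is
    compared with its value where [u] first reaches [d] or [1 - d], and the flux there costs only
    the slack [e]. *)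
Lemma flux_upper_bound (G : R -> R) (I : R) :
  (forall s, 0 <= s <= 1 -> 0 <= c + h s) ->
  (forall s : R, 0 < s < 1 -> is_derive s 1 G (D s `^ (q - 1) * g s)) ->
  (forall s : R, 0 < s < 1 -> 0 <= G s <= I) ->
  `|phi x1| `^ q <= q * I.
Proof.
move=> ch_ge0 dG GI; apply/ler_addgt0Pr => e e0.
pose e1 := e `^ q^-1.
have e10 : 0 < e1 by rewrite powR_gt0.
have e1q : e1 `^ q = e by rewrite -powRrM mulVf ?gt_eqF// powRr1// ltW.
have [d0 d00 phi0] := sol_flux_at0 usol e10.
have [d1 d10 phi1] := sol_flux_at1 usol e10.
have [theta0 theta1] := andP theta01.
near (0 : R)^'+ => d.
have d_gt0 : 0 < d by [].
have dd0 : d < d0 by near: d; exact: nbhs_right_lt.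
have dd1 : d < d1 by near: d; exact: nbhs_right_lt.
have dtheta : d < theta by near: d; exact: nbhs_right_lt.
have dtheta1 : d < 1 - theta.
  by near: d; apply: nbhs_right_lt; rewrite subr_gt0.
have [a ua] := cvg_ninfty_bound (sol_lim_ninfty usol) d_gt0.
(* The minimum is nonnegative exactly when [d <= u x <= 1 - d]. It is positive at [x1] and negative
   far to the left, where [u > 1 - d]. *)
have [||||x2 [/andP[_ x21] ux2 x2P]] :=
  @last_entry _ (fun x => Num.min (u x - d) (1 - d - u x)) (Num.min a x1) x1.
- move=> x.
  apply: (@continuous_min _ _ (fun x => u x - d) (fun x => 1 - d - u x)).
    by apply: cvgB; [exact: sol_continuous usol x|exact: cvg_cst].
  by apply: cvgB; [exact: cvg_cst|exact: sol_continuous usol x].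
- by rewrite ge_min lexx orbT.
- have /ua : Num.min a x1 <= a by rewrite ge_min lexx.
  by rewrite ltr_norml ge_min => /andP[_ ?]; apply/orP; right; lra.
- by rewrite ux1 le_min; apply/andP; split; lra.
have u01 x : x2 <= x <= x1 -> 0 < u x < 1.
  by move=> /x2P; rewrite le_min => /andP[? ?]; lra.
have phix2 : `|phi x2| < e1.
  have : u x2 = d \/ u x2 = 1 - d.
    by move: ux2; case: (leP (u x2 - d)) => _ ?; [left|right]; lra.
  case=> Eu; [apply: phi0|apply: phi1]; rewrite Eu.
    by rewrite gtr0_norm.
  by rewrite addrAC subrr sub0r normrN gtr0_norm.
have := energy_nincr p1 usol D_gt0 ch_ge0 dG x21 u01.
have /GI/andP[_ Gx2] := u01 x2 ltac:(by rewrite lexx).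
rewrite ux1; have /andP[Gtheta _] := GI _ theta01.
rewrite -/phi -/q => En.
have phiq : `|phi x2| `^ q <= e.
  by rewrite -e1q ge0_ler_powR ?nnegrE ?powR_ge0// ltW.
(* [G theta >= 0] is dropped on the left, and [G (u x2) <= I] is used on the right. *)
have : `|phi x1| `^ q / q <= I + e / q.
  apply: (@le_trans _ _ (G (u x2) + `|phi x2| `^ q / q)).
    by apply: le_trans En; rewrite lerDr.
  by rewrite lerD// ler_pM2r// invr_gt0.
by rewrite ler_pdivrMr// mulrDl divfK ?gt_eqF// [I * q]mulrC.
Unshelve. all: by end_near. Qed.

(** The conserved quantity is compared at [x1] and at the first later point [y] with [u y = d].
    There [phi y] and [c * d + H d] are each below [e / 2] in absolute value, so the sum at [x1] is
    at most [- phi x1 + e]. *)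
Lemma flux_lower_bound (H : R -> R) :
  (forall s, 0 <= s <= theta -> g s = 0) ->
  (forall s : R, 0 < s < 1 -> is_derive s 1 H (h s)) ->
  H s @[s --> 0] --> 0 ->
  (forall y, x1 <= y -> u y <= theta) ->
  c * theta + H theta <= `|phi x1|.
Proof.
move=> g_eq0 dH H0 ux1P; apply/ler_addgt0Pr => e e0.
have e20 : 0 < e / 2 by lra.
have [d0 d00 phi0] := sol_flux_at0 usol e20.
have [theta0 theta1] := andP theta01.
have cH : c * s + H s @[s --> 0^'+] --> 0.
  apply: cvg_at_right_filter.
  by have := cvgD (cvgM (cvg_cst c) cvg_id) H0; rewrite mulr0 addr0; exact.
near (0 : R)^'+ => d.
have d_gt0 : 0 < d by [].
have dd0 : d < d0 by near: d; exact: nbhs_right_lt.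
have dtheta : d < theta by near: d; exact: nbhs_right_lt.
have : `|0 - (c * d + H d)| < e / 2.
  by near: d; move/cvgrPdist_lt: cH; exact.
rewrite sub0r normrN => cHd.
have [b ub] := cvg_pinfty_bound (sol_lim_pinfty usol) d_gt0.
have [||||y [/andP[x1y _] /eqP uy yP]] :=
  @first_exit _ (fun x => u x - d) x1 (Num.max b x1).
- by move=> x; apply: cvgB; [exact: sol_continuous usol x|exact: cvg_cst].
- by rewrite le_max lexx orbT.
- by rewrite ux1; lra.
- have /ub : b <= Num.max b x1 by rewrite le_max lexx.
  by rewrite ltr_norml => /andP[? _]; lra.
move: uy; rewrite subr_eq0 => /eqP uy.
have utheta x : x1 <= x <= y -> 0 < u x <= theta.
  by move=> /[dup] /yP ? /andP[/ux1P ? _]; lra.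
have := flux_conserved usol g_eq0 theta1 dH x1y utheta.
rewrite ux1 uy -/phi => Ephi.
have phiy : `|phi y| < e / 2 by apply: phi0; rewrite uy gtr0_norm.
have := ler_norm (- phi x1); rewrite normrN.
by move: phiy cHd; rewrite !ltr_norml => /andP[? ?] /andP[? ?] ?; lra.
Unshelve. all: by end_near. Qed.

End bounds.

(** Both flux bounds are applied at the last point of height [theta], and the upper one is turned
    into a bound on [|phi x1|] by a q-th root. *)
Lemma threshold_bound (R : realType) (p c theta : R) (D h g u : R -> R) :
  1 < p -> 0 < theta < 1 -> C1_on `]0, 1[ D ->
  (forall s : R, 0 < s < 1 -> 0 < D s) ->
  {within `[0, 1], continuous h} -> {within `[0, 1], continuous g} ->
  (forall s : R, 0 <= s <= theta -> g s = 0) ->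
  (forall s : R, 0 < s < 1 -> 0 <= g s) ->
  (\int[@lebesgue_measure R]_(s in `]0%R, 1%R[)
    (D s `^ (conj_exp p - 1) * g s)%:E < +oo)%E ->
  (forall s : R, 0 <= s <= 1 -> 0 <= c + h s) ->
  is_solution p D h g c u ->
  c * theta + primitive0 h theta <=
  (conj_exp p * \int[@lebesgue_measure R]_(s in `]0, 1[)
    (D s `^ (conj_exp p - 1) * g s)) `^ (1 / conj_exp p).
Proof.
move=> p1 theta01 D_C1 D_gt0 h_cont g_cont g_eq0 g_ge0 Dg_int ch_ge0 usol.
have q0 : 0 < conj_exp p by apply: lt_trans (conj_exp_gt1 p1).
have [x1 [ux1 ux1P]] := last_at_level usol theta01.
have [G [dG G_ge0 G_le]] := weighted_primitive D_C1 D_gt0 g_cont g_ge0 Dg_int.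
have up := flux_upper_bound p1 theta01 D_gt0 usol ux1 ch_ge0 dG
  (fun s s01 => introT andP (conj (G_ge0 s s01) (G_le s s01))).
apply: le_trans (flux_lower_bound theta01 usol ux1 g_eq0
  (is_derive_primitive0 h_cont) (primitive0_cvg0 h_cont) ux1P) _.
have powRK (x : R) : 0 <= x -> (x `^ conj_exp p) `^ (1 / conj_exp p) = x.
  by move=> x0; rewrite -powRrM mulrCA mulfV ?gt_eqF// mulr1 powRr1.
rewrite -[leLHS](powRK _ (normr_ge0 _)) ge0_ler_powR ?nnegrE ?powR_ge0//.
  by rewrite divr_ge0// ltW.
exact: le_trans (powR_ge0 _ _) up.
Qed.

Theorem theorem2p4 (R : realType) (p theta hm : R) (D h g : R -> R)
  (p_gt1 : 1 < p)
  (D_C1 : C1_on `]0, 1[ D)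
  (D_gt0 : forall s : R, 0 < s < 1 -> 0 < D s)
  (h_cont : {within `[0, 1], continuous h})
  (h_min : is_min_on `[0, 1] h hm)
  (theta01 : 0 < theta < 1)
  (g_cont : {within `[0, 1], continuous g})
  (g_eq0 : forall s : R, 0 <= s <= theta -> g s = 0)
  (g_gt0 : forall s : R, theta < s < 1 -> 0 < g s)
  (g_1 : g 1 = 0)
  (Dg_int : (\int[@lebesgue_measure R]_(s in `]0%R, 1%R[)
    (D s `^ (conj_exp p - 1) * g s)%:E < +oo)%E) :
  (theta * hm +
     (conj_exp p * \int[@lebesgue_measure R]_(s in `]0, 1[)
        (D s `^ (conj_exp p - 1) * g s)) `^ (1 / conj_exp p)
     <= primitive0 h theta ->
   forall c : R, - hm < c -> ~ exists u : R -> R, is_solution p D h g c u)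
  /\
  (theta * hm +
     (conj_exp p * \int[@lebesgue_measure R]_(s in `]0, 1[)
        (D s `^ (conj_exp p - 1) * g s)) `^ (1 / conj_exp p)
     < primitive0 h theta ->
   forall c : R, - hm <= c -> ~ exists u : R -> R, is_solution p D h g c u).
Proof.
have g_ge0 s : 0 < s < 1 -> 0 <= g s.
  move=> /andP[s0 s1]; have [stheta|thetas] := leP s theta.
    by rewrite g_eq0// stheta ltW.
  by rewrite ltW// g_gt0// thetas.
have key c u : - hm <= c -> is_solution p D h g c u ->
    c * theta + primitive0 h theta <=
    (conj_exp p * \int[@lebesgue_measure R]_(s in `]0, 1[)
       (D s `^ (conj_exp p - 1) * g s)) `^ (1 / conj_exp p).
  move=> hmc; apply: threshold_bound => // s s01.
  have : hm <= h s by apply: h_min.2; rewrite /= in_itv.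
  by move=> ?; lra.
have /andP[theta0 _] := theta01.
(* The threshold bound and [Hle] together give theta (c + hm) <= 0, or < 0 when [Hle] is strict,
   against the sign of [c + hm]. *)
split=> Hle c hmc [u usol].
- have := key c u (ltW hmc) usol.
  have : 0 < theta * (c + hm) by rewrite mulr_gt0//; lra.
  by move=> ? ?; lra.
- have := key c u hmc usol.
  have : 0 <= theta * (c + hm) by rewrite mulr_ge0//; lra.
  by move=> ? ?; lra.
Qed.
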